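(* Let $X$ be an isotropic $L$-space, $\omega$ a modulus of continuity, $t\in[a,b]$, $h>0$, and $\mathcal D_H(t)f=\mathcal D_Hf(t)$ for $f\in W^1H^\omega([a,b],X)$. If $h_1=\min\{h,t-a\}$, $h_2=\min\{h,b-t\}$, and $$\delta=\frac{h_1+h_2}2\max\{\omega(h_1),\omega(h_2)\}-\frac{I(h_1)+I(h_2)}2,\qquad I(\alpha)=\int_0^\alpha\omega(s)\,ds,$$ then for the operator $\Delta_{h_1,h_2}(t)f=\Delta^H_{h_1,h_2}f(t)$ we have $$\mathcal E_\delta(\mathcal D_H(t))=U_\delta(\mathcal D_H(t),\Delta_{h_1,h_2}(t))=\max\{\omega(h_1),\omega(h_2)\}.$$
   Context: A modulus of continuity is a non-decreasing continuous semi-additive function $\omega\colon[0,\infty)\to[0,\infty)$ (i.e. $\omega(s+t)\le\omega(s)+\omega(t)$) with $\omega(0)=0$. A semilinear space is a set $X$ with addition and multiplication by real numbers such that for all $x,y,z\in X$, $\alpha,\beta\in\mathbb R$: $x+y=y+x$; $x+(y+z)=(x+y)+z$; there is $\theta\in X$ with $x+\theta=x$ for all $x$; $\alpha(x+y)=\alpha x+\alpha y$; $\alpha(\beta x)=(\alpha\beta)x$; $1\cdot x=x$, $0\cdot x=\theta$. An $L$-space is a semilinear space $X$ with a complete separable metric $h_X$ such that $h_X(\alpha x,\alpha y)=|\alpha|h_X(x,y)$ and $h_X(x+z,y+z)\le h_X(x,y)$; it is isotropic if the last inequality is always an equality. An element $x$ is convex if $(\alpha+\beta)x=\alpha x+\beta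 x$ for all $\alpha,\beta\ge0$; $X^{\rm c}$ is the set of convex elements. An element $x$ is invertible if there is $x'\in X$ with $x+x'=\theta$; $X^{\rm inv}$ is the set of invertible elements. Standing assumption: $X^{\rm inv}\cap X^{\rm c}\ne\{\theta\}$. $X$ is equipped with a fixed convexifying operator $P$: a surjection $P\colon X\to X^{\rm c}$ with $h_X(P(x),P(y))\le h_X(x,y)$, $P\circ P=P$, $P(\alpha x+\beta y)=\alpha P(x)+\beta P(y)$ for all $x,y\in X$, $\alpha,\beta\in\mathbb R$. Integral: for a simple mapping $f$ taking values $f_1,\dots,f_n$ on pairwise disjoint measurable sets $T_1,\dots,T_n$, $\int f(s)\,ds:=\sum_iP(f_i)\mu(T_i)$ ($\mu$ the Lebesgue measure); for a uniform limit $f$ of simple mappings $f^k$ (in particular for continuous $f$), $\int f:=\lim_k\int f^k$. Hukuhara type difference: $z=x-_Hy$ means $x=y+z$ (unique, if it exists, in an isotropic space). $f$ has Hukuhara type derivative $\mathcal D_Hf(t)$ at $t\in(a,b)$ if for all small $\gamma>0$ the differences $f(t+\gamma)-_Hf(t)$, $f(t)-_Hf(t-\gamma)$ exist and the limits as $\gamma\to+0$ of $\gamma^{-1}(f(t+\gamma)-_Hf(t))$ and $\gamma^{-1}(f(t)-_Hf(t-\gamma))$ exist and coincide; $\mathcal D_Hf(t)$ is the common limit (one-sided at $t=a,b$). Divided difference: $\Delta^H_{h_1,h_2}f(t)=\frac{1}{h_1+h_2}\bigl(f(t+h_2)-_Hf(t-h_1)\bigr)$. $H^\omega([a,b],X)$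 is the class of $f\colon[a,b]\to X$ with $h_X(f(t'),f(t''))\le\omega(|t'-t''|)$ for all $t',t''\in[a,b]$. $W^1H^\omega([a,b],X)$ is the class of functions $f(t)=x+\int_a^t\phi(s)\,ds$ with $\phi\in H^\omega([a,b],X)$, $x\in X^{\rm c}$; for such $f$, $\mathcal D_Hf=P(\phi)$. Notation: $\|x\|_X=h_X(x,\theta)$; $C([a,b],X)$ is the space of continuous functions $[a,b]\to X$ with metric $h_{C([a,b],X)}(f,g)=\max_th_X(f(t),g(t))$, and $\|f\|_{C([a,b],X)}=\sup_{t\in[a,b]}\|f(t)\|_X$. $C^H([a,b],X)$ is the set of $f\in C([a,b],X)$ such that $\Delta^H_{\gamma_1,\gamma_2}f(s)$ exists whenever $\gamma_1,\gamma_2>0$ and $[s-\gamma_1,s+\gamma_2]\subset[a,b]$. A positively homogeneous operator $T\colon C^H([a,b],X)\to X$ is bounded if $\sup\{\|Tf\|_X:f\in C^H([a,b],X),\|f\|_{C([a,b],X)}\le1\}<\infty$. For an operator $A\colon W^1H^\omega([a,b],X)\to X$ and a bounded positively homogeneous $T\colon C^H([a,b],X)\to X$, $$U_\delta(A,T)=\sup\{h_X(Af,Tg):f\in W^1H^\omega([a,b],X),\ g\in C^H([a,b],X),\ h_{C([a,b],X)}(f,g)\le\delta\},$$ and $\mathcal E_\delta(A)=\inf_TU_\delta(A,T)$, the infimum over all bounded positively homogeneous operators $T\colon C^H([a,b],X)\to X$. *)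

(* Defs.v *)
From HB Require Import structures.
From mathcomp Require Import all_boot all_order all_algebra.
From mathcomp Require Import all_classical all_reals all_analysis.

Set Implicit Arguments.
Unset Strict Implicit.
Unset Printing Implicit Defensive.

Import Order.TTheory GRing.Theory Num.Theory.
Import numFieldNormedType.Exports.

Local Open Scope classical_set_scope.
Local Open Scope ring_scope.

(* The algebraic and the metric structure are introduced together because the
   hierarchy has no join of [nmodType] and [metricType]. [lSemiModType R] would
   not fit anyway: its scaling is additive in the scalar, which here holds only
   on convex elements. *)
HB.mixin Record Metric_isLSpace (R : realType) X & Metric R X & Complete X := {
  ladd : X -> X -> X ;
  ltheta : X ;
  lscale : R -> X -> X ;
  laddC : commutative ladd ;
  laddA : associative ladd ;
  laddr0 : forall x, ladd x ltheta = x ;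
  lscaleDr : forall c x y, lscale c (ladd x y) = ladd (lscale c x) (lscale c y) ;
  lscaleA : forall c d x, lscale c (lscale d x) = lscale (c * d) x ;
  lscale1 : forall x, lscale 1 x = x ;
  lscale0 : forall x, lscale 0 x = ltheta ;
  mdist_lscale : forall c x y,
    mdist (lscale c x) (lscale c y) = `|c| * mdist x y ;
  mdist_laddr_le : forall x y z,
    mdist (ladd x z) (ladd y z) <= mdist x y ;
  lspace_separable : exists S : set X, countable S /\ dense S
}.

#[short(type="lspaceType")]
HB.structure Definition LSpace (R : realType) :=
  {X of Metric R X & Complete X & Metric_isLSpace R X}.

Notation "x +s y" := (ladd x y) (at level 50, left associativity) : ring_scope.
Notation "c *s x" := (lscale c x) (at level 40, left associativity) : ring_scope.

Definition isotropic (R : realType) (X : lspaceType R) : Prop :=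
  forall x y z : X, mdist (x +s z) (y +s z) = mdist x y.

Definition convex_elements (R : realType) (X : lspaceType R) : set X :=
  [set x | forall c d : R, 0 <= c -> 0 <= d -> (c + d) *s x = c *s x +s d *s x].

Definition invertible_elements (R : realType) (X : lspaceType R) : set X :=
  [set x | exists x', x +s x' = ltheta].

Definition lnorm (R : realType) (X : lspaceType R) (x : X) : R := mdist x ltheta.

Definition convexifying (R : realType) (X : lspaceType R) (P : X -> X) : Prop :=
  [/\ range P = @convex_elements R X,
      forall x y, mdist (P x) (P y) <= mdist x y,
      forall x, P (P x) = P x &
      forall (c d : R) (x y : X), P (c *s x +s d *s y) = c *s P x +s d *s P y].

Definition modulus_of_continuity (R : realType) (omega : R -> R) : Prop :=
  [/\ forall s : R, 0 <= s -> 0 <= omega s,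
      forall s t : R, 0 <= s -> s <= t -> omega s <= omega t,
      {within `[0, +oo[, continuous omega},
      forall s t : R, 0 <= s -> 0 <= t -> omega (s + t) <= omega s + omega t &
      omega 0 = 0].

(* [simple_integral P D f v]: f is simple on D, with value [c i] on the Lebesgue
   measurable set [T i], and v is the integral computed from this
   representation. [completed_lebesgue_measure] is the Lebesgue measure on the
   full Lebesgue sigma-algebra (as opposed to the Borel one). *)
Definition simple_integral (R : realType) (X : lspaceType R) (P : X -> X)
    (D : set R) (f : R -> X) (v : X) : Prop :=
  exists (n : nat) (c : 'I_n -> X) (T : 'I_n -> set R),
    [/\ forall i, (wlength (@idfun R))^*%mu.-cara.-measurable (T i),
        trivIset setT T,
        \bigcup_i T i = D,
        forall i s, T i s -> f s = c i &
        v = \big[ladd/ltheta]_(i < n)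
          (fine (@completed_lebesgue_measure R (T i)) *s P (c i))].

Definition is_lintegral (R : realType) (X : lspaceType R) (P : X -> X)
    (D : set R) (f : R -> X) (v : X) : Prop :=
  exists (F : nat -> R -> X) (V : nat -> X),
    [/\ forall k, simple_integral P D (F k) (V k),
        {uniform D, F @ \oo --> f} &
        V @ \oo --> v].

(* [ltheta] when f is not integrable over D. *)
Definition lintegral (R : realType) (X : lspaceType R) (P : X -> X)
    (D : set R) (f : R -> X) : X :=
  xget ltheta [set v | is_lintegral P D f v].

(* The Hukuhara type difference; unique in an isotropic space, and [ltheta] when it
   does not exist. *)
Definition hdiff_exists (R : realType) (X : lspaceType R) (x y : X) : Prop :=
  exists z, x = y +s z.

Definition hdiff (R : realType) (X : lspaceType R) (x y : X) : X :=
  xget ltheta [set z | x = y +s z].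

Definition is_right_hderiv (R : realType) (X : lspaceType R)
    (f : R -> X) (t : R) (z : X) : Prop :=
  (\forall g \near 0^'+, hdiff_exists (f (t + g)) (f t)) /\
  (g^-1 *s hdiff (f (t + g)) (f t)) @[g --> 0^'+] --> z.

Definition is_left_hderiv (R : realType) (X : lspaceType R)
    (f : R -> X) (t : R) (z : X) : Prop :=
  (\forall g \near 0^'+, hdiff_exists (f t) (f (t - g))) /\
  (g^-1 *s hdiff (f t) (f (t - g))) @[g --> 0^'+] --> z.

(* Functions on [a, b] are represented by functions on R of which only the
   values on [a, b] matter. *)
Definition is_hderiv (R : realType) (X : lspaceType R) (a b : R)
    (f : R -> X) (t : R) (z : X) : Prop :=
  (t < b -> is_right_hderiv f t z) /\ (a < t -> is_left_hderiv f t z).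

Definition hderiv (R : realType) (X : lspaceType R) (a b t : R)
    (f : R -> X) : X :=
  xget ltheta [set z | is_hderiv a b f t z].

Definition divdiff (R : realType) (X : lspaceType R) (h1 h2 t : R)
    (f : R -> X) : X :=
  (h1 + h2)^-1 *s hdiff (f (t + h2)) (f (t - h1)).

Definition Homega (R : realType) (X : lspaceType R) (omega : R -> R)
    (a b : R) : set (R -> X) :=
  [set f | forall t1 t2 : R, t1 \in `[a, b] -> t2 \in `[a, b] ->
    mdist (f t1) (f t2) <= omega `|t1 - t2|].

Definition W1Homega (R : realType) (X : lspaceType R) (P : X -> X)
    (omega : R -> R) (a b : R) : set (R -> X) :=
  [set f | exists (x : X) (phi : R -> X),
    [/\ convex_elements x, Homega omega a b phi &
        forall t : R, t \in `[a, b] -> f t = x +s lintegral P `[a, t] phi]].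

Definition Cdist (R : realType) (X : lspaceType R) (a b : R)
    (f g : R -> X) : \bar R :=
  ereal_sup [set (mdist (f t) (g t))%:E | t in `[a, b]].

Definition Cnorm (R : realType) (X : lspaceType R) (a b : R)
    (f : R -> X) : \bar R :=
  ereal_sup [set (lnorm (f t))%:E | t in `[a, b]].

Definition CH (R : realType) (X : lspaceType R) (a b : R) : set (R -> X) :=
  [set f | {within `[a, b], continuous f} /\
    forall s g1 g2 : R, 0 < g1 -> 0 < g2 -> `[s - g1, s + g2] `<=` `[a, b] ->
      hdiff_exists (f (s + g2)) (f (s - g1))].

(* The first clause makes T an operator on functions on [a, b]; the values of T
   outside [CH a b] play no role. *)
Definition bounded_poshom (R : realType) (X : lspaceType R) (a b : R) :
    set ((R -> X) -> X) :=
  [set T | [/\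
    forall f g, CH a b f -> CH a b g -> {in `[a, b], f =1 g} -> T f = T g,
    forall (c : R) f, 0 < c -> CH a b f -> T (fun s => c *s f s) = c *s T f &
    (ereal_sup [set (lnorm (T f))%:E | f in
       [set f | CH a b f /\ (Cnorm a b f <= 1)%E]] < +oo)%E]].

Definition Udelta (R : realType) (X : lspaceType R) (P : X -> X)
    (omega : R -> R) (a b delta : R) (A T : (R -> X) -> X) : \bar R :=
  ereal_sup [set (mdist (A fg.1) (T fg.2))%:E | fg in
    [set fg : (R -> X) * (R -> X) |
      [/\ W1Homega P omega a b fg.1, CH a b fg.2 &
          (Cdist a b fg.1 fg.2 <= delta%:E)%E]]].

Definition Edelta (R : realType) (X : lspaceType R) (P : X -> X)
    (omega : R -> R) (a b delta : R) (A : (R -> X) -> X) : \bar R :=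
  ereal_inf [set Udelta P omega a b delta A T | T in @bounded_poshom R X a b].

(* Main.v *)
(* Upper bound: f(t+h2) -_H f(t-h1) is the integral of phi over [t-h1, t+h2]
   and D_H f(t) = P(phi t), so by the modulus of continuity
   (h1+h2) h(D_H f(t), Delta f(t)) <= I(h1) + I(h2); replacing f by g costs at
   most 2 delta more, and delta is chosen so that the total is (h1+h2) M, where
   M = max (omega h1) (omega h2).
   Lower bound: a positively homogeneous T maps the zero function to theta, so
   it suffices to find f in the class, within delta of zero, whose derivative at
   t has norm M. Along an isometric copy e of the real line, take
   phi(s) = e(max(0, M - omega |s - t|)), whose integral over [a, b] has length
   at most 2 delta, and centre its primitive at theta. *)
Require Import Defs.
From HB Require Import structures.
From mathcomp Require Import all_boot all_order all_algebra.
From mathcomp Require Import all_classical all_reals all_analysis.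
From mathcomp Require Import ring lra.

Set Implicit Arguments.
Unset Strict Implicit.
Unset Printing Implicit Defensive.

Import Order.TTheory GRing.Theory Num.Theory.
Import numFieldNormedType.Exports.

Local Open Scope classical_set_scope.
Local Open Scope ring_scope.

(** * Algebra and metric of L-spaces, Hukuhara differences *)

Lemma ladd0r (R : realType) (X : lspaceType R) : left_id ltheta (@ladd R X).
Proof. by move=> x; rewrite laddC laddr0. Qed.

HB.instance Definition _ (R : realType) (X : lspaceType R) :=
  Monoid.isComLaw.Build X ltheta ladd laddA laddC (@ladd0r R X).

Local Notation cvg_mdistP := metricType_numDomainType.cvgrPdist_lt.
Local Notation cvg_mdist_lt := metricType_numDomainType.cvgr_dist_lt.

Section LSpaceTheory.
Context {R : realType} {X : lspaceType R}.
Implicit Types (x y z : X) (c d : R).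

Lemma lscaler0 c : c *s ltheta = ltheta :> X.
Proof. by rewrite -(lscale0 ltheta) lscaleA mulr0. Qed.

Lemma mdist_ladd x y z w : mdist (x +s y) (z +s w) <= mdist x z + mdist y w.
Proof.
apply: (le_trans (metric_triangle _ (z +s y) _)); apply: lerD.
  exact: mdist_laddr_le.
by rewrite ![z +s _]laddC mdist_laddr_le.
Qed.

Lemma mdist_lsum n (x y : 'I_n -> X) :
  mdist (\big[ladd/ltheta]_(i < n) x i) (\big[ladd/ltheta]_(i < n) y i)
  <= \sum_(i < n) mdist (x i) (y i).
Proof.
elim/big_rec3: _ => [|i s v u _ le_uv]; first by rewrite mdistxx.
by apply: (le_trans (mdist_ladd _ _ _ _)); rewrite lerD2l.
Qed.

Lemma cvg_ladd {T : Type} {F : set_system T} {FF : Filter F} (f g : T -> X) x y :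
  f @ F --> x -> g @ F --> y -> (fun k => f k +s g k) @ F --> x +s y.
Proof.
move=> fx gy; apply/cvg_mdistP => e e0; near=> k.
apply: (le_lt_trans (mdist_ladd _ _ _ _)); rewrite [e]splitr ltrD//.
  by near: k; apply: cvg_mdist_lt => //; rewrite divr_gt0.
by near: k; apply: cvg_mdist_lt => //; rewrite divr_gt0.
Unshelve. all: by end_near. Qed.

Lemma convex_lscale x c : convex_elements x -> convex_elements (c *s x).
Proof.
move=> cx d e d0 e0.
by rewrite lscaleA [_ * c]mulrC -lscaleA cx// lscaleDr !lscaleA ![c * _]mulrC.
Qed.

(** This is where convexity enters integration: cutting a measurable piece into smaller ones cuts
    its mass into nonnegative parts, and the value [P (c i)] carried by the piece is convex. *)
Lemma convex_lsum x n (c : 'I_n -> R) :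
    convex_elements x -> (forall i, 0 <= c i) ->
  (\sum_(i < n) c i) *s x = \big[ladd/ltheta]_(i < n) (c i *s x).
Proof.
move=> cx; elim: n c => [|n IH] c c0; first by rewrite !big_ord0 lscale0.
by rewrite !big_ord_recl cx// ?IH// sumr_ge0.
Qed.

Lemma convexifying_convex (P : X -> X) x : convexifying P -> convex_elements (P x).
Proof. by move=> [Pim _ _ _]; rewrite -Pim; exists x. Qed.

Lemma convexifying_id (P : X -> X) x :
  convexifying P -> convex_elements x -> P x = x.
Proof. by move=> [Pim _ PP _]; rewrite -Pim => -[y _ <-]. Qed.

Hypothesis hiso : isotropic X.

Lemma mdist_ladd2l z x y : mdist (z +s x) (z +s y) = mdist x y.
Proof. by rewrite ![z +s _]laddC hiso. Qed.

(** Isotropy replaces opposites: translation preserves distances, hence is injective, and Hukuhara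
    differences are unique. *)
Lemma laddI z : injective (ladd z).
Proof.
by move=> x y zxy; apply: mdist_positivity; rewrite -(mdist_ladd2l z) zxy mdistxx.
Qed.

Lemma hdiffE x y z : x = y +s z -> hdiff x y = z.
Proof.
move=> xyz; rewrite /hdiff; case: xgetP => [w _ /= xyw|/(_ z)//].
by apply: (@laddI y); rewrite -xyz -xyw.
Qed.

Lemma hdiff_exists_add x y : hdiff_exists x y -> x = y +s hdiff x y.
Proof. by move=> [z xyz]; rewrite (hdiffE xyz). Qed.

(** Translation by [y1 +s y2] preserves the distance and turns the two differences into [y2 +s x1]
    and [y1 +s x2]. *)
Lemma mdist_hdiff x1 y1 x2 y2 :
    hdiff_exists x1 y1 -> hdiff_exists x2 y2 ->
  mdist (hdiff x1 y1) (hdiff x2 y2) <= mdist x1 x2 + mdist y1 y2.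
Proof.
move=> /hdiff_exists_add e1 /hdiff_exists_add e2.
rewrite -(mdist_ladd2l (y1 +s y2)) -{1}[y1 +s y2]laddC -!laddA -e2.
rewrite laddA [_ +s y1]laddC [y1 +s y2]laddC -laddA -e1.
by rewrite addrC (le_trans (mdist_ladd _ _ _ _))// [mdist y2 y1]metric_sym.
Qed.

End LSpaceTheory.

(** * Lebesgue measure of intervals and finite partitions *)

Section Measure.
Context {R : realType}.
Local Notation lmeas := ((wlength (@idfun R))^*%mu.-cara.-measurable).
Local Notation mu := (@completed_lebesgue_measure R).
Implicit Types A D : set R.

Lemma lmeas_itv (i : interval R) : lmeas [set` i].
Proof. by apply: sub_caratheodory; exact: measurable_itv. Qed.

Lemma completed_lebesgue_measure_itvcc (c d : R) : c <= d ->
  mu `[c, d] = (d - c)%:E.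
Proof.
move=> cd; have := @lebesgue_measure_itv R `[c, d]%R.
(* The completed measure and [lebesgue_measure] are the same set function up to conversion; only
   their sigma-algebras differ. *)
rewrite /= lte_fin -EFinB => e; transitivity (@lebesgue_measure R `[c, d]) => //.
by rewrite e; case: ltgtP cd => // -> _; rewrite subrr.
Qed.

Lemma fine_measure_split A n (T : 'I_n -> set R) :
    lmeas A -> (mu A < +oo)%E -> (forall i, lmeas (T i)) ->
    trivIset setT T -> A `<=` \bigcup_i T i ->
  fine (mu A) = \sum_(i < n) fine (mu (A `&` T i)).
Proof.
move=> mA Aoo mT tT AT.
have mAT i : lmeas (A `&` T i) by exact: measurableI.
have ATE : A = \big[setU/set0]_(i < n) (A `&` T i).
  rewrite -bigcup_pred -setI_bigcupr; apply/esym/setIidPl.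
  by move=> s /AT [i _ Ti]; exists i.
rewrite {1}ATE measure_bigsetU_ord//; last exact: trivIset_setIl.
rewrite sum_fine// => i _; rewrite ge0_fin_numE//.
by apply: le_lt_trans Aoo; apply: le_measure; rewrite ?inE//; exact: subIsetl.
Qed.

End Measure.

(** * The integral of uniform limits of simple functions *)

Section Integral.
Context {R : realType} {X : lspaceType R}.
Local Notation lmeas := ((wlength (@idfun R))^*%mu.-cara.-measurable).
Local Notation mu := (@completed_lebesgue_measure R).
Variable P : X -> X.
Hypothesis hP : convexifying P.
Implicit Types (D : set R) (f g : R -> X) (v w : X).

Let measI_fin D A : lmeas D -> (mu D < +oo)%E -> lmeas A ->
  (mu (D `&` A) < +oo)%E.
Proof.
move=> mD Doo mA; apply: le_lt_trans Doo.
by apply: le_measure; rewrite ?inE//; exact: measurableI.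
Qed.

Lemma simple_integral_measurable D f v : simple_integral P D f v -> lmeas D.
Proof.
move=> [n [c [T [mT _ <- _ _]]]].
by apply: fin_bigcup_measurable => //; exact: finite_finset.
Qed.

(** Both integrals are rewritten over the common refinement [T i]&[S j], then compared cell by cell,
    [P] being a contraction. With [f = g] and [r = 0] this also shows independence of the
    representation. *)
Lemma simple_integral_dist D f g v w r :
    (mu D < +oo)%E -> simple_integral P D f v -> simple_integral P D g w ->
    (forall s, D s -> mdist (f s) (g s) <= r) ->
  mdist v w <= fine (mu D) * r.
Proof.
move=> Doo /[dup] /simple_integral_measurable mD.
move=> [n [c [T [mT tT TD fT ->]]]] [m [d [S [mS tS SD gS ->]]]] fg.
have TDi i : T i `<=` D by rewrite -TD => s ?; exists i.
have SDi i : S i `<=` D by rewrite -SD => s ?; exists i.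
have Too i : (mu (T i) < +oo)%E by rewrite -(setIidr (TDi i)) measI_fin.
have Soo i : (mu (S i) < +oo)%E by rewrite -(setIidr (SDi i)) measI_fin.
have cvxP x : convex_elements (P x) by exact: convexifying_convex.
have TE i : fine (mu (T i)) *s P (c i) =
    \big[ladd/ltheta]_(j < m) (fine (mu (T i `&` S j)) *s P (c i)).
  rewrite (fine_measure_split (mT i) (Too i) mS tS) ?SD// convex_lsum// => j.
  exact: fine_ge0.
have SE j : fine (mu (S j)) *s P (d j) =
    \big[ladd/ltheta]_(i < n) (fine (mu (S j `&` T i)) *s P (d j)).
  rewrite (fine_measure_split (mS j) (Soo j) mT tT) ?TD// convex_lsum// => i.
  exact: fine_ge0.
rewrite (eq_bigr _ (fun i _ => TE i)) (eq_bigr _ (fun j _ => SE j)).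
rewrite [X in mdist _ X]exchange_big/=.
apply: (le_trans (mdist_lsum _ _)).
rewrite (fine_measure_split mD Doo mT tT) ?TD// big_distrl/= ler_sum// => i _.
rewrite (setIidr (TDi i)) (fine_measure_split (mT i) (Too i) mS tS) ?SD//.
apply: (le_trans (mdist_lsum _ _)); rewrite big_distrl/= ler_sum// => j _.
rewrite [S j `&` _]setIC mdist_lscale ger0_norm ?fine_ge0//.
(* The bound [r] on [mdist (c i) (d j)] is known only through a point of the cell; an empty cell has
   mass 0. *)
have [[s [Ts Ss]]|/nonemptyPn ->] := pselect (T i `&` S j !=set0); last first.
  by rewrite measure0 !mul0r.
rewrite ler_wpM2l ?fine_ge0//; case: hP => _ Ple _ _.
by apply: (le_trans (Ple _ _)); rewrite -(fT _ _ Ts) -(gS _ _ Ss) fg//; apply: TDi Ts.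
Qed.

Lemma uniform_mdistP D (F : nat -> R -> X) f :
  {uniform D, F @ \oo --> f} <->
  forall e : R, 0 < e -> \forall k \near \oo, forall s, D s -> mdist (f s) (F k s) < e.
Proof.
split.
  move=> FF e e0.
  have /FF : nbhs (f : {uniform` D -> X})
      [set h | forall s, D s -> mdist (f s) (h s) < e].
    apply/uniform_nbhs; exists [set xy : X * X | ball xy.1 e xy.2]; split.
      exact: entourage_ball (PosNum e0).
    by move=> h Dh s /Dh /=; rewrite ballEmdist.
  exact.
move=> FF A /uniform_nbhs[E [/= + EA]]; rewrite -entourage_ballE => -[e /= e0 eE].
have := FF _ e0; apply: filterS => k Dk; apply: EA => s Ds; apply: eE.
by rewrite /= ballEmdist; exact: Dk.
Qed.

Lemma is_lintegral_dist D f g v w r :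
    (mu D < +oo)%E -> is_lintegral P D f v -> is_lintegral P D g w ->
    (forall s, D s -> mdist (f s) (g s) <= r) ->
  mdist v w <= fine (mu D) * r.
Proof.
move=> Doo [F [V [FV /uniform_mdistP Ff Vv]]] [G [W [GW /uniform_mdistP Gg Ww]]] fg.
apply/ler_addgt0Pl => e e0.
have m0 : 0 < fine (mu D) + 1 by rewrite ltr_wpDl// fine_ge0.
(* With [m] the measure of [D], the two limits cost [2 d] and the two uniform approximations
   [m * 2 d], in total [(m + 1) * 2 d = e]. *)
pose d := e / (fine (mu D) + 1) / 2.
have d0 : 0 < d by rewrite !divr_gt0.
have [k [Fk Gk Vk Wk]] : exists k, [/\ forall s, D s -> mdist (f s) (F k s) < d,
    forall s, D s -> mdist (g s) (G k s) < d, mdist v (V k) < d & mdist w (W k) < d].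
  near \oo => k; exists k; split.
  - by near: k; exact: Ff.
  - by near: k; exact: Gg.
  - by near: k; exact: cvg_mdist_lt.
  - by near: k; exact: cvg_mdist_lt.
have VW : mdist (V k) (W k) <= fine (mu D) * (r + d *+ 2).
  apply: simple_integral_dist (FV k) (GW k) _ => // s Ds.
  rewrite (le_trans (metric_triangle _ (f s) _))//.
  rewrite (le_trans (lerD (lexx _) (metric_triangle _ (g s) _)))//.
  have := fg _ Ds; have := Fk _ Ds; have := Gk _ Ds.
  rewrite [mdist (F k s) _]metric_sym; lra.
have -> : e = (fine (mu D) + 1) * (d *+ 2).
  by rewrite /d -mulr_natr divfK// mulrCA divff ?mulr1// gt_eqF.
rewrite (le_trans (metric_triangle _ (V k) _))//.
rewrite (le_trans (lerD (lexx _) (metric_triangle _ (W k) _)))//.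
rewrite [mdist (W k) w]metric_sym.
lra.
Unshelve. all: by end_near. Qed.

Lemma is_lintegral_unique D f v w : (mu D < +oo)%E ->
  is_lintegral P D f v -> is_lintegral P D f w -> v = w.
Proof.
move=> Doo fv fw; apply/mdist_positivity/eqP; rewrite eq_le mdist_ge0 andbT.
rewrite -(mulr0 (fine (mu D))); apply: is_lintegral_dist fv fw _ => // s _.
by rewrite mdistxx.
Qed.

Lemma lintegralE D f v : (mu D < +oo)%E -> is_lintegral P D f v ->
  lintegral P D f = v.
Proof.
move=> Doo fv; rewrite /lintegral; case: xgetP => [w _ /= fw|/(_ v)//].
exact: is_lintegral_unique fw fv.
Qed.

Lemma is_lintegral_cst D x : lmeas D ->
  is_lintegral P D (fun=> x) (fine (mu D) *s P x).
Proof.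
move=> mD; exists (fun=> fun=> x), (fun=> fine (mu D) *s P x); split.
- move=> _; exists 1, (fun=> x), (fun=> D); split => //.
  + by move=> i j _ _ _; rewrite !ord1.
  + by rewrite bigcup_const//; exists ord0.
  + by rewrite big_ord1.
- by apply/uniform_mdistP => e e0; near=> k => s _; rewrite mdistxx.
- exact: cvg_cst.
Unshelve. all: by end_near. Qed.

(** By [simple_integral_dist] the integrals [V k] form a Cauchy sequence, and [X] is complete.
    Keeping the convergence of the given [V] in the conclusion allows identities between simple
    integrals to pass to the limit. *)
Lemma uniform_cvg_simple_integral D (F : nat -> R -> X) f V :
    (mu D < +oo)%E -> (forall k, simple_integral P D (F k) (V k)) ->
    {uniform D, F @ \oo --> f} ->
  exists2 v, is_lintegral P D f v & V @ \oo --> v.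
Proof.
move=> Doo FV Ff.
suff /cvg_ex[v Vv] : cvg (V @ \oo) by exists v => //; exists F, V.
apply/cauchy_cvgP/cauchy_exP => e e0.
have m0 : 0 < fine (mu D) + 1 by rewrite ltr_wpDl// fine_ge0.
pose d := e / (fine (mu D) + 1) / 2.
have d0 : 0 < d by rewrite !divr_gt0.
have /uniform_mdistP/(_ _ d0) FFd := Ff; near \oo => N.
exists (V N); change (\forall k \near \oo, ball (V N) e (V k)).
near=> k; rewrite ballEmdist/=.
have Nd : forall s, D s -> mdist (f s) (F N s) < d by near: N.
have kd : forall s, D s -> mdist (f s) (F k s) < d by near: k.
have : mdist (V N) (V k) <= fine (mu D) * (d *+ 2).
  apply: simple_integral_dist (FV N) (FV k) _ => // s Ds.
  have := Nd s Ds; have := kd s Ds => ? ?; rewrite (le_trans (metric_triangle _ (f s) _))// [mdist _ (f s)]metric_sym; lra.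
have -> : e = (fine (mu D) + 1) * (d *+ 2).
  by rewrite /d -mulr_natr divfK// mulrCA divff ?mulr1// gt_eqF.
move=> /le_lt_trans; apply; rewrite mulrDl ltrDl mul1r; lra.
Unshelve. all: by end_near. Qed.

End Integral.

(** * Moduli of continuity and increments of real functions *)

Section RealLemmas.
Context {R : realType}.
Implicit Types (omega g E : R -> R) (a c d s u v : R).

Lemma modulus_small omega e : modulus_of_continuity omega -> 0 < e ->
  exists2 d, 0 < d & forall s, 0 <= s -> s < d -> omega s < e.
Proof.
move=> [om0 omle /continuous_within_itvcyP[_ omc] _ omz] e0.
have := cvgr_dist_lt _ _ omc e e0; rewrite omz => -[d /= d0 dE].
exists d => // s; rewrite le_eqVlt => /predU1P[<-|s0] sd; first by rewrite omz.
have := dE s; rewrite /= !sub0r !normrN gtr0_norm// ger0_norm ?om0 ?ltW//; exact.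
Qed.

(** For [u <= s], semi-additivity gives [omega s <= omega (s - u) + omega u]. *)
Lemma modulus_dist omega s u : modulus_of_continuity omega ->
  0 <= s -> 0 <= u -> `|omega s - omega u| <= omega `|s - u|.
Proof.
move=> [om0 omle _ omD _]; wlog : s u / u <= s => [wl s0 u0|us s0 u0].
  by have [/wl|/ltW /wl] := leP u s; [exact|rewrite distrC [`|s - u|]distrC; exact].
have su0 : 0 <= s - u by rewrite subr_ge0.
rewrite !ger0_norm// ?subr_ge0 ?omle//.
by rewrite lerBlDr (le_trans _ (omD _ _ _ _))// subrK.
Qed.

Lemma modulus_continuous omega g : modulus_of_continuity omega ->
  (forall s u, `|g s - g u| <= omega `|s - u|) -> continuous g.
Proof.
move=> hom gom s; apply/cvgrPdist_lt => e e0.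
have [d d0 dom] := modulus_small hom e0.
apply: filterS (nbhsx_ballx s _ d0) => u su.
exact/(le_lt_trans (gom _ _))/dom.
Qed.

(* Summing over the n-th uniform partition of [0, L], the errors add up to
   C * L * omega (L / n). *)
Lemma increments_le0 omega E (C L : R) : modulus_of_continuity omega -> 0 <= L ->
    E 0 <= 0 ->
    (forall y k, 0 <= y -> 0 <= k -> y + k <= L ->
       E (y + k) <= E y + C * (k * omega k)) ->
  E L <= 0.
Proof.
move=> hom L0 E0 Ei; have C0 : 0 <= `|C| by [].
apply/ler_addgt0Pl => e e0; rewrite addr0.
(* The accumulated error is at most [|C| * L * omega k], to be made smaller than [e]; the [+ 1]
   keeps the divisor positive when [C * L = 0]. *)
have LC0 : 0 < `|C| * L + 1 by rewrite ltr_wpDl// mulr_ge0.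
have [d d0 dom] := modulus_small hom (divr_gt0 e0 LC0).
have [n nd] : exists n : nat, L / n.+1%:R < d.
  have Ld : 0 <= L / d by rewrite divr_ge0// ltW.
  have /andP[_ h] := truncn_itv Ld; exists (Num.truncn (L / d)).
  by rewrite ltr_pdivrMr// mulrC -ltr_pdivrMr.
set k := L / n.+1%:R in nd.
have k0 : 0 <= k by rewrite divr_ge0.
have Lk : L = n.+1%:R * k by rewrite mulrC divfK.
have step i : (i <= n.+1)%N -> E (i%:R * k) <= i%:R * (C * (k * omega k)).
  elim: i => [|i IH] il; first by rewrite !mul0r.
  rewrite -natr1 mulrDl mul1r [leRHS]mulrDl mul1r.
  apply: (le_trans (Ei _ _ _ _ _)); rewrite ?mulr_ge0 ?lerD2r ?IH ?(ltnW il)//.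
  by rewrite Lk -[X in _ + X]mul1r -mulrDl natr1 ler_wpM2r// ler_nat.
have := step _ (leqnn _); rewrite -Lk => /le_trans; apply.
have -> : n.+1%:R * (C * (k * omega k)) = C * L * omega k by rewrite Lk; ring.
have om0 : 0 <= omega k by case: hom => + _ _ _ _; exact.
rewrite (@le_trans _ _ (`|C| * L * omega k))//.
  by rewrite !ler_wpM2r// ler_norm.
have := ltW (dom _ k0 nd); rewrite ler_pdivlMr// => /(le_trans _); apply.
by rewrite mulrC ler_wpM2l// lerDl.
Qed.

Lemma Rintegral_increment g c d u v (lo hi : R) : {within `[c, d], continuous g} ->
    c <= u -> u <= v -> v <= d ->
    (forall s, u <= s -> s <= v -> lo <= g s <= hi) ->
  (v - u) * lo <= \int[@lebesgue_measure R]_(s in `[c, v]) g s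
                - \int[@lebesgue_measure R]_(s in `[c, u]) g s <= (v - u) * hi.
Proof.
move=> gc cu uv vd gb.
have gi p q : c <= p -> q <= d ->
    (@lebesgue_measure R).-integrable `[p, q] (EFin \o g).
  move=> cp qd; apply: continuous_compact_integrable; first exact: segment_compact.
  apply: continuous_subspaceW gc; apply: subset_itvScc; rewrite bnd_simp//.
rewrite Rintegral_itvB ?bnd_simp//; last exact: gi.
rewrite Rintegral_itv_obnd_cbnd; last first.
  by apply: integrableS (gi u v cu vd) => //; exact: subset_itv_oc_cc.
have cstE (r : R) : \int[@lebesgue_measure R]_(s in `[u, v]) r = (v - u) * r.
  rewrite Rintegral_cst// mulrC; congr (_ * _).
  by have /(congr1 (@fine R)) := completed_lebesgue_measure_itvcc uv.
have icst (r : R) : (@lebesgue_measure R).-integrable `[u, v] (EFin \o cst r).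
  by apply: continuous_compact_integrable; [exact: segment_compact|exact: cst_continuous].
rewrite -!cstE; apply/andP; split; apply: le_Rintegral => //; do ?exact: gi.
- exact: icst.
- by move=> s /=; rewrite in_itv/= => /andP[us sv]; case/andP: (gb s us sv).
- exact: icst.
- by move=> s /=; rewrite in_itv/= => /andP[us sv]; case/andP: (gb s us sv).
Qed.

End RealLemmas.

(** * Existence and additivity of the integral on intervals *)

Section IntegralItv.
Context {R : realType} {X : lspaceType R}.
Local Notation lmeas := ((wlength (@idfun R))^*%mu.-cara.-measurable).
Local Notation mu := (@completed_lebesgue_measure R).
Variables (P : X -> X) (omega : R -> R).
Hypothesis hP : convexifying P.
Hypothesis hom : modulus_of_continuity omega.
Implicit Types (A B D : set R) (f g : R -> X) (v w : X) (c d s : R).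

Let itv_lty c d : c <= d -> (mu `[c, d] < +oo)%E.
Proof. by move=> cd; rewrite completed_lebesgue_measure_itvcc// ltry. Qed.

(** A null overlap is allowed because the closed intervals [[c, d]] and [[d, e]] share the point
    [d]. *)
Lemma fine_measure_setU_null A B T :
    lmeas A -> lmeas B -> lmeas T -> mu (A `&` B) = 0%E ->
    (mu T < +oo)%E -> T `<=` A `|` B ->
  fine (mu T) = fine (mu (T `&` A)) + fine (mu (T `&` B)).
Proof.
move=> mA mB mT AB0 Too TAB.
have fin S : lmeas S -> S `<=` T -> mu S \is a fin_num.
  move=> mS ST; rewrite ge0_fin_numE//; apply: le_lt_trans Too.
  by apply: le_measure; rewrite ?inE.
have mTA : lmeas (T `&` A) by exact: measurableI.
have mTB : lmeas (T `&` B) by exact: measurableI.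
have muT : mu T = (mu (T `\` A) + mu (T `&` A))%E by exact: measureDI.
have : mu (T `&` B) = (mu (T `&` B `\` A) + mu (T `&` B `&` A))%E.
  exact: measureDI.
have -> : mu (T `&` B `&` A) = 0%E.
  apply/eqP; rewrite eq_le measure_ge0 andbT -AB0; apply: le_measure.
  - by rewrite inE; exact: measurableI.
  - by rewrite inE; exact: measurableI.
  - by move=> s [[_ ?] ?].
have -> : T `&` B `\` A = T `\` A.
  by apply/seteqP; split => [s [[]]|s [Ts As]] //; case: (TAB _ Ts).
have mTDA : lmeas (T `\` A) by exact: measurableD.
rewrite adde0 muT => ->.
have TDAf := fin _ mTDA (@subDsetl _ T A).
have TAf := fin _ mTA (@subIsetl _ T A).
by rewrite (fineD TDAf TAf) addrC.
Qed.

Lemma simple_integral_setU_null A B f v :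
    lmeas A -> lmeas B -> mu (A `&` B) = 0%E -> (mu (A `|` B) < +oo)%E ->
    simple_integral P (A `|` B) f v ->
  exists v1 v2, [/\ simple_integral P A f v1, simple_integral P B f v2 &
    v = v1 +s v2].
Proof.
move=> mA mB AB0 ABoo [n [x [T [mT tT TAB fT ->]]]].
exists (\big[ladd/ltheta]_(i < n) (fine (mu (A `&` T i)) *s P (x i))).
exists (\big[ladd/ltheta]_(i < n) (fine (mu (B `&` T i)) *s P (x i))).
have TS i : T i `<=` A `|` B by rewrite -TAB => s ?; exists i.
split.
- exists n, x, (fun i => A `&` T i); split => //.
  + by move=> i; exact: measurableI.
  + exact: trivIset_setIl.
  + by rewrite -setI_bigcupr TAB; apply/setIidPl; exact: subsetUl.
  + by move=> i s [_]; exact: fT.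
- exists n, x, (fun i => B `&` T i); split => //.
  + by move=> i; exact: measurableI.
  + exact: trivIset_setIl.
  + by rewrite -setI_bigcupr TAB; apply/setIidPl; exact: subsetUr.
  + by move=> i s [_]; exact: fT.
rewrite -big_split/=; apply: eq_bigr => i _.
rewrite (@fine_measure_setU_null A B)//.
  rewrite (convexifying_convex _ hP) ?fine_ge0// 1?setIC//.
  by rewrite [B `&` _]setIC.
apply: le_lt_trans ABoo; apply: le_measure; rewrite ?inE//.
exact: measurableU.
Qed.

(** The approximants of [f] on the union are restricted to [A] and to [B]; both sequences of
    integrals converge, and uniqueness of limits identifies the sum of the limits with [v]. *)
Lemma is_lintegral_setU_null A B f v :
    lmeas A -> lmeas B -> mu (A `&` B) = 0%E -> (mu (A `|` B) < +oo)%E ->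
    is_lintegral P (A `|` B) f v ->
  exists v1 v2, [/\ is_lintegral P A f v1, is_lintegral P B f v2 &
    v = v1 +s v2].
Proof.
move=> mA mB AB0 ABoo [F [V [FV Ff Vv]]].
have /choice[V12 FV12] : forall k, exists w : X * X,
    [/\ simple_integral P A (F k) w.1, simple_integral P B (F k) w.2 &
      V k = w.1 +s w.2].
  move=> k; have [v1 [v2 h]] := simple_integral_setU_null mA mB AB0 ABoo (FV k).
  by exists (v1, v2).
have oo D : lmeas D -> D `<=` A `|` B -> (mu D < +oo)%E.
  move=> mD DAB; apply: le_lt_trans ABoo; apply: le_measure; rewrite ?inE//.
  exact: measurableU.
have FfA : {uniform A, F @ \oo --> f}.
  by apply: uniform_subset_cvg Ff; exact: subsetUl.
have FfB : {uniform B, F @ \oo --> f}.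
  by apply: uniform_subset_cvg Ff; exact: subsetUr.
have [v1 fv1 Vv1] : exists2 v1, is_lintegral P A f v1 & (fst \o V12) @ \oo --> v1.
  apply: uniform_cvg_simple_integral FfA => //; first exact/oo/subsetUl.
  by move=> k; case: (FV12 k).
have [v2 fv2 Vv2] : exists2 v2, is_lintegral P B f v2 & (snd \o V12) @ \oo --> v2.
  apply: uniform_cvg_simple_integral FfB => //; first exact/oo/subsetUr.
  by move=> k; case: (FV12 k).
exists v1, v2; split => //; apply: (cvg_unique (@metric_hausdorff R X)) Vv _.
have -> : V = fun k => (fst \o V12) k +s (snd \o V12) k.
  by apply/funext => k; case: (FV12 k).
exact: cvg_ladd.
Qed.

(** The step function samples [f] at the last point not beyond [s] of the grid of mesh [1 / n.+1]
    starting at [c]; [truncn] is the floor since [c <= s]. *)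
Lemma step_simple_integral c d f n : c <= d ->
  exists v, simple_integral P `[c, d]
    (fun s => f (c + (Num.truncn ((s - c) * n.+1%:R))%:R / n.+1%:R)) v.
Proof.
move=> cd; have n0 : 0 < n.+1%:R :> R by [].
(* The successor includes the cell that contains [d] itself. *)
pose N := (Num.truncn ((d - c) * n.+1%:R)).+1.
pose p (i : nat) : R := c + i%:R / n.+1%:R.
exists (\big[ladd/ltheta]_(i < N)
  (fine (mu (`[c, d] `&` `[p i, p i.+1[)) *s P (f (p i)))).
exists N, (fun i => f (p i)), (fun i => `[c, d] `&` `[p i, p i.+1[).
have piP s i : c <= s -> (s \in `[p i, p i.+1[) =
    (Num.truncn ((s - c) * n.+1%:R) == i).
  move=> cs; rewrite in_itv/= /p -lerBrDl -ltrBlDl ler_pdivrMr// ltr_pdivlMr//.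
  apply/idP/eqP => [|<-]; first exact: truncn_def.
  by apply: truncn_itv; rewrite mulr_ge0// subr_ge0.
split => //.
- by move=> i; apply: measurableI; exact: lmeas_itv.
- move=> i j _ _ [s [[]]]/=; rewrite [s \in `[c, d]]in_itv/= => /andP[cs _].
  rewrite piP// => /eqP si [_]; rewrite piP// => /eqP sj.
  by apply: val_inj; rewrite /= -si -sj.
- rewrite -setI_bigcupr; apply/setIidPl => s /=; rewrite in_itv/= => /andP[cs sd].
  have sN : (Num.truncn ((s - c) * n.+1%:R) < N)%N.
    by rewrite ltnS le_truncn// ler_wpM2r// lerB.
  by exists (Ordinal sN) => //=; rewrite piP.
- move=> i s [/=]; rewrite in_itv/= => /andP[cs _]; rewrite piP// => /eqP si.
  by rewrite si.
Qed.

(** A point and its grid point are less than [1 / n.+1] apart, so the modulus of continuity makes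
    the step functions converge uniformly. *)
Lemma Homega_is_lintegral c d f : c <= d -> Homega omega c d f ->
  exists v, is_lintegral P `[c, d] f v.
Proof.
move=> cd fom.
have /choice[V FV] n := @step_simple_integral c d f n cd.
suff Ff : {uniform `[c, d], (fun (n : nat) s =>
    f (c + (Num.truncn ((s - c) * n.+1%:R))%:R / n.+1%:R)) @ \oo --> f}.
  have [|v fv _] := uniform_cvg_simple_integral hP _ FV Ff; last by exists v.
  exact: itv_lty.
apply/uniform_mdistP => e e0; have [r r0 omr] := modulus_small hom e0.
near=> n => s /=; rewrite in_itv/= => /andP[cs sd].
have nr : n.+1%:R^-1 < r by near: n; exact: (near_infty_natSinv_lt (PosNum r0)).
have n0 : 0 < n.+1%:R :> R by [].
have s0 : 0 <= (s - c) * n.+1%:R by rewrite mulr_ge0// subr_ge0.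
have /andP[] := truncn_itv s0; set i := Num.truncn _.
rewrite -ler_pdivrMr// -ltr_pdivlMr// -[i.+1%:R]natr1 mulrDl mul1r => is_ si_.
have i0 : 0 <= i%:R / n.+1%:R :> R by rewrite divr_ge0.
set p := i%:R / _ in is_ si_ i0 *; set q := n.+1%:R^-1 in si_ nr *.
clearbody p q.
apply: (le_lt_trans (fom _ _ _ _)); rewrite ?in_itv/= ?cs//.
  by rewrite lerDl i0/=; lra.
by apply: omr => //; rewrite ger0_norm; lra.
Unshelve. all: by end_near. Qed.

Variables (a b : R) (phi : R -> X).
Hypothesis phiom : Homega omega a b phi.

Local Notation L c d := (lintegral P `[c, d] phi).

Lemma Homega_lintegral c d : a <= c -> c <= d -> d <= b ->
  is_lintegral P `[c, d] phi (L c d).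
Proof.
move=> ac cd db.
have phicd : Homega omega c d phi.
  move=> s1 s2; rewrite !in_itv/= => /andP[cs1 s1d] /andP[cs2 s2d].
  by apply: phiom; rewrite in_itv/=; apply/andP; split; lra.
have [v phiv] := Homega_is_lintegral cd phicd.
by rewrite (lintegralE hP _ phiv)//; exact: itv_lty.
Qed.

Lemma lintegral_itvD c d e : a <= c -> c <= d -> d <= e -> e <= b ->
  L c e = L c d +s L d e.
Proof.
move=> ac cd de eb; have ce := le_trans cd de.
have cdeE : `[c, e]%classic = `[c, d] `|` `[d, e] :> set R.
  apply/seteqP; split => s; rewrite /= !in_itv/=.
    by move=> /andP[-> ->]; rewrite andbT; apply/orP; exact: le_total.
  by move=> []/andP[h1 h2]; apply/andP; split; lra.
have dd0 : mu (`[c, d] `&` `[d, e]) = 0%E.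
  rewrite (_ : _ `&` _ = `[d, d]%classic); last first.
    apply/seteqP; split => s; rewrite /= !in_itv/=.
      by move=> [/andP[_ ->] /andP[->]].
    by move=> /andP[h1 h2]; split; apply/andP; split; lra.
  by rewrite completed_lebesgue_measure_itvcc// subrr.
have := Homega_lintegral ac ce eb; rewrite {1}cdeE.
move=> /(is_lintegral_setU_null (lmeas_itv _) (lmeas_itv _) dd0)[].
  by rewrite -cdeE; exact: itv_lty.
move=> v1 [v2 [phiv1 phiv2 ->]].
by rewrite (lintegralE hP _ phiv1) ?(lintegralE hP _ phiv2)//; exact: itv_lty.
Qed.

(** The comparison is with the constant function [x], whose integral is [(d - c) *s P x]. *)
Lemma lintegral_itv_dist c d x r : a <= c -> c <= d -> d <= b ->
    (forall s, c <= s -> s <= d -> mdist (phi s) x <= r) ->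
  mdist (L c d) ((d - c) *s P x) <= (d - c) * r.
Proof.
move=> ac cd db phix.
have mE : fine (mu `[c, d]) = d - c by rewrite completed_lebesgue_measure_itvcc.
have := is_lintegral_dist hP _ (Homega_lintegral ac cd db)
  (is_lintegral_cst P x (lmeas_itv `[c, d]%R)).
rewrite mE; apply.
  exact: itv_lty.
by move=> s /=; rewrite in_itv/= => /andP[]; exact: phix.
Qed.

Lemma lintegral_itvxx c : a <= c -> c <= b -> L c c = ltheta.
Proof.
move=> ac cb; have := @lintegral_itv_dist c c (phi c) 0 ac (lexx c) cb.
rewrite subrr mul0r lscale0 => h; apply: mdist_positivity.
apply/eqP; rewrite eq_le mdist_ge0 andbT h// => s cs sc.
by rewrite (@le_anti _ _ s c) ?cs ?sc// mdistxx.
Qed.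

End IntegralItv.

(** * Comparison of accumulated errors with the integral of the modulus *)

Section ModulusIntegral.
Context {R : realType}.
Variable omega : R -> R.
Hypothesis hom : modulus_of_continuity omega.
Local Notation I x := (\int[@lebesgue_measure R]_(s in `[0, x]) omega s).

Lemma modulus_integral_increment (y k : R) : 0 <= y -> 0 <= k ->
  k * omega y <= I (y + k) - I y <= k * omega (y + k).
Proof.
move=> y0 k0; case: (hom) => _ omle omc _ _.
have -> : k = y + k - y by ring.
have -> : y + (y + k - y) = y + k by ring.
apply: (@Rintegral_increment _ _ 0 (y + k)) => //; first 1 last.
- by rewrite lerDl.
- by move=> s ys sk; rewrite !omle// (le_trans y0).
- apply: continuous_subspaceW omc => s; rewrite /= !in_itv/= andbT.
  by case/andP.
Qed.

Lemma modulus_integral0 : I 0 = 0.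
Proof. by rewrite set_itv1 Rintegral_set1. Qed.

(** A step of length [k] costs at most [k * omega (y + k)], while [I] grows by at least
    [k * omega y]; by semi-additivity the excess is at most [k * omega k], which [increments_le0]
    absorbs. Keeping [G] abstract serves integrals growing to the right and to the left. *)
Lemma mdist_increments_le (X : lspaceType R) (G : R -> X) (x : X) (L : R) :
    0 <= L -> convex_elements x -> G 0 = ltheta ->
    (forall y k, 0 <= y -> 0 <= k -> y + k <= L -> exists2 z,
      G (y + k) = G y +s z & mdist z (k *s x) <= k * omega (y + k)) ->
  mdist (G L) (L *s x) <= I L.
Proof.
move=> L0 cx G0 Gi; rewrite -subr_le0.
pose E (y : R) := mdist (G y) (y *s x) - I y.
apply: (@increments_le0 R omega E 1 L) => //.
  by rewrite /E G0 lscale0 mdistxx modulus_integral0 subr0.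
move=> y k y0 k0 ykL; have [z Gz zx] := Gi y k y0 k0 ykL.
have /andP[Ii _] := modulus_integral_increment y0 k0.
rewrite /E Gz cx//; have := mdist_ladd (G y) z (y *s x) (k *s x).
have : k * omega (y + k) <= k * (omega y + omega k).
  by rewrite ler_wpM2l//; case: hom => _ _ _ + _; exact.
lra.
Qed.

End ModulusIntegral.

(** * Differentiation of the indefinite integral *)

Section HukuharaDerivative.
Context {R : realType} {X : lspaceType R}.
Variables (P : X -> X) (omega : R -> R).
Hypothesis hP : convexifying P.
Hypothesis hom : modulus_of_continuity omega.
Hypothesis hiso : isotropic X.
Variables (a b : R) (phi : R -> X).
Hypothesis phiom : Homega omega a b phi.

Local Notation L c d := (lintegral P `[c, d] phi).
Local Notation I x := (\int[@lebesgue_measure R]_(s in `[0, x]) omega s).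

Let phi_dist u s : a <= u -> u <= b -> a <= s -> s <= b ->
  mdist (phi s) (phi u) <= omega `|s - u|.
Proof. by move=> au ub as_ sb; apply: phiom; rewrite in_itv/= ?au ?as_. Qed.

Lemma lintegral_right_dist u y : a <= u -> 0 <= y -> u + y <= b ->
  mdist (L u (u + y)) (y *s P (phi u)) <= I y.
Proof.
move=> au y0 uyb; case: (hom) => _ omle _ _ _.
apply: (@mdist_increments_le _ _ hom _ (fun y => L u (u + y))) => //.
- exact: convexifying_convex.
- by rewrite addr0 (lintegral_itvxx hP hom phiom)//; lra.
move=> z k z0 k0 zky; exists (L (u + z) (u + (z + k))).
  by apply: (lintegral_itvD hP hom phiom); lra.
have {2 3}-> : k = u + (z + k) - (u + z) by ring.
apply: (lintegral_itv_dist hP hom phiom); try lra.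
move=> s us su; apply: (le_trans (phi_dist _ _ _ _)); try lra.
by rewrite ger0_norm ?omle//; lra.
Qed.

(** Here the interval grows at its left end, so each new piece is the left summand and commutativity
    brings it to the form of [mdist_increments_le]. *)
Lemma lintegral_left_dist u y : a <= u - y -> 0 <= y -> u <= b ->
  mdist (L (u - y) u) (y *s P (phi u)) <= I y.
Proof.
move=> auy y0 ub; case: (hom) => _ omle _ _ _.
apply: (@mdist_increments_le _ _ hom _ (fun y => L (u - y) u)) => //.
- exact: convexifying_convex.
- by rewrite subr0 (lintegral_itvxx hP hom phiom)//; lra.
move=> z k z0 k0 zky; exists (L (u - (z + k)) (u - z)).
  by rewrite laddC; apply: (lintegral_itvD hP hom phiom); lra.
have {2 3}-> : k = u - z - (u - (z + k)) by ring.
apply: (lintegral_itv_dist hP hom phiom); try lra.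
move=> s us su; apply: (le_trans (phi_dist _ _ _ _)); try lra.
by rewrite distrC ger0_norm ?omle//; lra.
Qed.

(** Since [I g <= g * omega g], the average differs from [x] by at most [omega g], which tends to
    0. *)
Let cvg_average (G : R -> X) (x : X) (r : R) : 0 < r ->
    (forall g, 0 < g -> g <= r -> mdist (G g) (g *s x) <= I g) ->
  (g^-1 *s G g) @[g --> 0^'+] --> x.
Proof.
move=> r0 Gx; apply/cvg_mdistP => e e0; have [d d0 dom] := modulus_small hom e0.
near=> g.
have g0 : 0 < g by near: g; exact: nbhs_right_gt.
have gr : g <= r by near: g; exact: nbhs_right_le.
have gd : g < d by near: g; exact: nbhs_right_lt.
rewrite -{1}(lscale1 x) -(mulVf (lt0r_neq0 g0)) -lscaleA mdist_lscale.
rewrite gtr0_norm ?invr_gt0// mulrC ltr_pdivrMr// metric_sym.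
apply: (le_lt_trans (Gx _ g0 gr)).
have /andP[_] := modulus_integral_increment hom (lexx 0) (ltW g0).
rewrite add0r modulus_integral0 subr0 => /le_lt_trans; apply.
by rewrite mulrC ltr_pM2r// dom// ltW.
Unshelve. all: by end_near. Qed.

Variables (x : X) (f : R -> X) (t : R).
Hypothesis fE : forall s, s \in `[a, b] -> f s = x +s L a s.

Lemma lintegral_increment c d : a <= c -> c <= d -> d <= b ->
  f d = f c +s L c d.
Proof.
move=> ac cd db; rewrite !fE ?in_itv/= ?ac ?(le_trans ac) ?(le_trans cd)//.
by rewrite -laddA (lintegral_itvD hP hom phiom _ ac).
Qed.

Hypothesis ht : t \in `[a, b].

Lemma lintegral_is_right_hderiv : t < b -> is_right_hderiv f t (P (phi t)).
Proof.
move: ht; rewrite in_itv/= => /andP[at_ _] tb.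
have bt : 0 < b - t by rewrite subr_gt0.
have fE' g : 0 < g -> g <= b - t -> f (t + g) = f t +s L t (t + g).
  by move=> g0 gb; apply: lintegral_increment; lra.
split.
  near=> g; exists (L t (t + g)); apply: fE'.
    by near: g; exact: nbhs_right_gt.
  by near: g; exact: nbhs_right_le.
apply: (cvg_average bt) => g g0 gb; rewrite (hdiffE hiso (fE' _ g0 gb)).
by apply: lintegral_right_dist; lra.
Unshelve. all: by end_near. Qed.

Lemma lintegral_is_left_hderiv : a < t -> is_left_hderiv f t (P (phi t)).
Proof.
move: ht; rewrite in_itv/= => /andP[_ tb] at_.
have bt : 0 < t - a by rewrite subr_gt0.
have fE' g : 0 < g -> g <= t - a -> f t = f (t - g) +s L (t - g) t.
  by move=> g0 gb; apply: lintegral_increment; lra.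
split.
  near=> g; exists (L (t - g) t); apply: fE'.
    by near: g; exact: nbhs_right_gt.
  by near: g; exact: nbhs_right_le.
apply: (cvg_average bt) => g g0 gb; rewrite (hdiffE hiso (fE' _ g0 gb)).
by apply: lintegral_left_dist; lra.
Unshelve. all: by end_near. Qed.

(** [hderiv] is a choice among the values satisfying [is_hderiv]. As [a < b], at least one one-sided
    condition is not vacuous at [t], and uniqueness of limits determines the value. *)
Lemma hderiv_lintegral : a < b -> hderiv a b t f = P (phi t).
Proof.
move=> ab; rewrite /hderiv; case: xgetP => [z _ [zr zl]|]; last first.
  move=> /(_ (P (phi t))) []; split; [exact: lintegral_is_right_hderiv|].
  exact: lintegral_is_left_hderiv.
have [tb|bt] := ltP t b.
  have [_ zc] := zr tb; have [_ Pc] := lintegral_is_right_hderiv tb.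
  exact: (cvg_unique (@metric_hausdorff R X)) zc Pc.
have at_ : a < t by lra.
have [_ zc] := zl at_; have [_ Pc] := lintegral_is_left_hderiv at_.
exact: (cvg_unique (@metric_hausdorff R X)) zc Pc.
Qed.

End HukuharaDerivative.

(** * An isometric copy of the real line and integrals along it *)

(* In an L-space (-1) *s x need not be the inverse of an invertible convex x
   (take the reals with c *s x := |c| x), so the negative half of the line is
   spanned by the inverse x' itself. *)
Lemma isometric_line (R : realType) (X : lspaceType R) : isotropic X ->
    @invertible_elements R X `&` @convex_elements R X <> [set ltheta] ->
  exists e : R -> X, [/\ forall s, convex_elements (e s),
    forall s r, e (s + r) = e s +s e r,
    forall c s, 0 <= c -> c *s e s = e (c * s) &
    forall s r, mdist (e s) (e r) = `|s - r|].
Proof.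
move=> hiso hinv.
(* [ltheta] lies in the intersection, so an intersection other than its singleton contains a further
   element. *)
have [x0 [[x0' x0x0'] cx0] x0N] : exists2 x : X,
    (@invertible_elements R X `&` @convex_elements R X) x & x <> ltheta.
  apply: contra_notP hinv => nex; apply/seteqP; split => [y Ay/=|y ->].
    by apply: contra_notP nex => yN; exists y.
  split; first by exists ltheta; rewrite laddr0.
  by move=> c d _ _; rewrite !lscaler0 laddr0.
have n0 : 0 < mdist x0 ltheta by rewrite mdist_gt0; apply/eqP.
pose x := (mdist x0 ltheta)^-1 *s x0; pose x' := (mdist x0 ltheta)^-1 *s x0'.
have xx' : x +s x' = ltheta by rewrite -lscaleDr x0x0' lscaler0.
have cx : convex_elements x by exact: convex_lscale.
have nx : mdist x ltheta = 1.
  rewrite -(lscaler0 (mdist x0 ltheta)^-1) mdist_lscale ger0_norm.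
    by rewrite mulVf// gt_eqF.
  by rewrite invr_ge0 ltW.
have cxx' c : c *s x +s c *s x' = ltheta by rewrite -lscaleDr xx' lscaler0.
(* Adding [(c + d) *s x] turns both sides of the convexity identity into [ltheta]; cancellation
   concludes. *)
have cx' : convex_elements x'.
  move=> c d c0 d0; apply: (laddI hiso (z := (c + d) *s x)); rewrite cxx' cx//.
  by rewrite -laddA [d *s x +s _]laddC -laddA [_ +s d *s x]laddC cxx' laddr0 cxx'.
clearbody x x'; pose w p q := p *s x +s q *s x'.
have wD p q p' q' : 0 <= p -> 0 <= q -> 0 <= p' -> 0 <= q' ->
    w (p + p') (q + q') = w p q +s w p' q'.
  by move=> *; rewrite /w cx// cx'// Monoid.mulmACA.
have w0 : w 0 0 = ltheta by rewrite /w !lscale0 laddr0.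
(* The positive part of [s] goes along [x] and the negative part along [x']; by [wE] below, [w p q]
   depends only on [p - q], the common part cancelling. *)
pose e (s : R) := w (Num.max s 0) (Num.max (- s) 0).
have wE p q : 0 <= p -> 0 <= q -> w p q = e (p - q).
  move=> p0 q0; rewrite /e; have [qp|/ltW pq] := leP q p.
    rewrite max_l ?max_r; [|lra..].
    by rewrite -[in LHS](subrK q p) -[X in w _ X](add0r q) wD ?subr_ge0//
      [w q q]cxx' laddr0.
  rewrite max_r ?max_l; [|lra..].
  by rewrite opprB -[in LHS](subrK p q) -[X in w X _](add0r p) wD ?subr_ge0//
    [w p p]cxx' laddr0.
have max0 (s : R) : 0 <= Num.max s 0 by rewrite le_max lexx orbT.
have maxK (s : R) : Num.max s 0 - Num.max (- s) 0 = s.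
  by have [s0|s0] := leP s 0; [rewrite max_l|rewrite max_r]; lra.
have eD s r : e (s + r) = e s +s e r.
  by rewrite -wD ?max0// wE ?addr_ge0 ?max0// opprD addrACA !maxK.
have e_ge0 s : 0 <= s -> e s = s *s x.
  by move=> s0; rewrite -[s in LHS]subr0 -wE// /w lscale0 laddr0.
exists e; split.
- move=> s c d c0 d0; rewrite /e /w !lscaleDr.
  by rewrite !(convex_lscale _ cx)// !(convex_lscale _ cx')// Monoid.mulmACA.
- exact: eD.
- move=> c s c0; rewrite {1}/e /w lscaleDr !lscaleA -[LHS]/(w _ _).
  by rewrite wE ?mulr_ge0// -mulrBr maxK.
move=> s r; wlog rs : s r / r <= s => [wl|].
  by have [/wl//|/ltW/wl] := leP r s; rewrite metric_sym distrC.
have -> : s = r + (s - r) by rewrite addrC subrK.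
rewrite eD -{2}(laddr0 (e r)) mdist_ladd2l// e_ge0 ?subr_ge0//.
rewrite -(lscaler0 (s - r)) mdist_lscale nx mulr1; congr `|_|; ring.
Qed.

(** Both sides are additive in the interval. On a piece of length [k] each is within [k * omega k]
    of [e (k * g u)], [u] being the left end, so [increments_le0] with constant 2 makes their
    distance 0. *)
Lemma lintegral_line (R : realType) (X : lspaceType R) (P : X -> X)
    (omega : R -> R) (e : R -> X) (g : R -> R) (a b s : R) :
    convexifying P -> modulus_of_continuity omega ->
    (forall s, convex_elements (e s)) ->
    (forall s r, e (s + r) = e s +s e r) ->
    (forall c s, 0 <= c -> c *s e s = e (c * s)) ->
    (forall s r, mdist (e s) (e r) = `|s - r|) ->
    (forall s u, `|g s - g u| <= omega `|s - u|) ->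
    a <= s -> s <= b ->
  lintegral P `[a, s] (e \o g)
    = e (\int[@lebesgue_measure R]_(r in `[a, s]) g r).
Proof.
move=> hP hom ecvx eD eM edist gom as_ sb.
have phiom : Homega omega a b (e \o g).
  by move=> u v _ _; rewrite /= edist gom.
pose J u := \int[@lebesgue_measure R]_(r in `[a, u]) g r; rewrite -/(J s).
apply/mdist_positivity/eqP; rewrite eq_le mdist_ge0 andbT.
pose E y := mdist (lintegral P `[a, a + y] (e \o g)) (e (J (a + y))).
have -> : s = a + (s - a) by rewrite addrC subrK.
rewrite -[leLHS]/(E (s - a)); apply: (@increments_le0 R omega E 2) => //.
- by rewrite subr_ge0.
- rewrite /E addr0 (lintegral_itvxx hP hom phiom)//; last lra.
  rewrite /J set_itv1 Rintegral_set1.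
  by rewrite -(lscale0 (e 0)) eM// mul0r mdistxx.
move=> y k y0 k0 yks; rewrite /E (lintegral_itvD hP hom phiom (d := a + y)); [|lra..].
set D := J (a + (y + k)) - J (a + y).
have -> : J (a + (y + k)) = J (a + y) + D by rewrite [RHS]addrC /D subrK.
rewrite eD (le_trans (mdist_ladd _ _ _ _))// lerD2l.
have kE : a + (y + k) - (a + y) = k by ring.
have gk u : a + y <= u -> u <= a + (y + k) -> `|g u - g (a + y)| <= omega k.
  move=> yu uk; rewrite (le_trans (gom _ _))//.
  by case: hom => _ omle _ _ _; rewrite omle// ger0_norm; lra.
apply: (le_trans (metric_triangle _ (k *s P (e (g (a + y)))) _)).
rewrite mulrDl mul1r lerD//.
  rewrite -{2 3}kE; apply: (lintegral_itv_dist hP hom phiom); try lra.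
  by move=> u yu uk; rewrite /= edist gk.
rewrite (convexifying_id hP (ecvx _)) eM// edist.
suff : (a + (y + k) - (a + y)) * (g (a + y) - omega k) <= D
    <= (a + (y + k) - (a + y)) * (g (a + y) + omega k).
  by rewrite kE !(mulrBr, mulrDr) ler_norml => /andP[? ?]; apply/andP; split; lra.
apply: (Rintegral_increment (d := s)); try lra.
  by apply: continuous_subspaceT; exact: modulus_continuous gom.
by move=> u yu uk; rewrite -ler_distl gk.
Qed.

(** * The extremal bump and its integral *)

Section ExtremalFunction.
Context {R : realType}.
Variable omega : R -> R.
Hypothesis hom : modulus_of_continuity omega.
Variables (t M : R).
Hypothesis M0 : 0 <= M.

Local Notation I x := (\int[@lebesgue_measure R]_(s in `[0, x]) omega s).

Definition bump (s : R) : R := Num.max 0 (M - omega `|s - t|).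

Local Notation J a s := (\int[@lebesgue_measure R]_(r in `[a, s]) bump r).

Lemma bump_ge0 s : 0 <= bump s.
Proof. by rewrite le_max lexx. Qed.

Lemma bump_center : bump t = M.
Proof. by rewrite /bump subrr normr0; case: hom => _ _ _ _ ->; rewrite subr0 max_r. Qed.

(** Truncation at 0 and [s |-> |s - t|] are both 1-Lipschitz, and [omega] has itself as modulus of
    continuity. *)
Lemma bump_dist s u : `|bump s - bump u| <= omega `|s - u|.
Proof.
apply: (@le_trans _ _ `|omega `|s - t| - omega `|u - t| |).
  rewrite /bump; move: (omega _) (omega _) => p q.
  have := ler_norm (p - q); have := ler_norm (q - p); rewrite [`|q - p|]distrC => h1 h2.
  rewrite ler_norml; apply/andP; split;
    by case: (leP 0 (M - p)) => ?; case: (leP 0 (M - q)) => ?; lra.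
apply: (le_trans (modulus_dist hom _ _)) => //.
case: hom => _ omle _ _ _; apply: omle => //.
by rewrite (le_trans (ler_dist_dist _ _))//; rewrite opprB addrA subrK.
Qed.

Lemma bump_integral_increment a u v (lo hi : R) : a <= u -> u <= v ->
    (forall s, u <= s -> s <= v -> lo <= bump s <= hi) ->
  (v - u) * lo <= J a v - J a u <= (v - u) * hi.
Proof.
move=> au uv; apply: (Rintegral_increment (d := v)) => //.
by apply: continuous_subspaceT; exact: modulus_continuous bump_dist.
Qed.

(** Since [omega h <= M], the truncation is inactive on [[t, t + h]]. On [[t + y, t + y + k]] the
    bump is at most [M - omega y], and replacing [k * omega y] by the increment of [I] costs at most
    [k * omega k]. *)
Lemma bump_integral_right a h : a <= t -> 0 <= h -> omega h <= M ->
  J a (t + h) - J a t <= h * M - I h.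
Proof.
move=> at_ h0 homM; case: (hom) => _ omle _ omD _; rewrite -subr_le0.
pose E y := J a (t + y) - J a t - (y * M - I y).
apply: (@increments_le0 R omega E 1 h) => //.
  by rewrite /E addr0 modulus_integral0; lra.
move=> y k y0 k0 ykh; rewrite /E.
have /andP[_ Ii] := modulus_integral_increment hom y0 k0.
have omk : k * omega (y + k) <= k * (omega y + omega k) by rewrite ler_wpM2l// omD.
suff /andP[_] : (t + (y + k) - (t + y)) * 0 <= J a (t + (y + k)) - J a (t + y)
    <= (t + (y + k) - (t + y)) * (M - omega y).
  have -> : t + (y + k) - (t + y) = k by ring.
  lra.
apply: bump_integral_increment; try lra.
move=> s ys syk; rewrite bump_ge0/= /bump ger0_norm; last lra.
rewrite max_r; first by rewrite lerB// omle//; lra.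
by rewrite subr_ge0 (le_trans _ homM)// omle//; lra.
Qed.

Lemma bump_integral_left a h : a <= t - h -> 0 <= h -> omega h <= M ->
  J a t - J a (t - h) <= h * M - I h.
Proof.
move=> at_ h0 homM; case: (hom) => _ omle _ omD _; rewrite -subr_le0.
pose E y := J a t - J a (t - y) - (y * M - I y).
apply: (@increments_le0 R omega E 1 h) => //.
  by rewrite /E subr0 modulus_integral0; lra.
move=> y k y0 k0 ykh; rewrite /E.
have /andP[_ Ii] := modulus_integral_increment hom y0 k0.
have omk : k * omega (y + k) <= k * (omega y + omega k) by rewrite ler_wpM2l// omD.
suff /andP[_] : (t - y - (t - (y + k))) * 0 <= J a (t - y) - J a (t - (y + k))
    <= (t - y - (t - (y + k))) * (M - omega y).
  have -> : t - y - (t - (y + k)) = k by ring.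
  lra.
apply: bump_integral_increment; try lra.
move=> s ys syk; rewrite bump_ge0/= /bump distrC ger0_norm; last lra.
rewrite max_r; first by rewrite lerB// omle//; lra.
by rewrite subr_ge0 (le_trans _ homM)// omle//; lra.
Qed.

End ExtremalFunction.

(** Used with [p = J s], [q = J b] and [d = delta]: starting the primitive at [- J b / 2] centres
    its range at 0. *)
Lemma norm_center_le (R : realType) (p q d : R) :
  0 <= p -> p <= q -> q <= d *+ 2 -> `|- (q / 2) + p| <= d.
Proof. by move=> *; rewrite ler_norml; apply/andP; split; lra. Qed.

(** * Upper and lower bounds for the recovery error *)

Section Recovery.
Context {R : realType} {X : lspaceType R}.
Variables (P : X -> X) (omega : R -> R) (a b t h : R).
Hypothesis hP : convexifying P.
Hypothesis hom : modulus_of_continuity omega.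
Hypothesis hiso : isotropic X.
Hypothesis hab : a < b.
Hypothesis ht : t \in `[a, b].
Hypothesis hh : 0 < h.

Local Notation h1 := (Num.min h (t - a)).
Local Notation h2 := (Num.min h (b - t)).
Local Notation I x := (\int[@lebesgue_measure R]_(s in `[0, x]) omega s).
Local Notation M := (Num.max (omega h1) (omega h2)).
Local Notation delta := ((h1 + h2) / 2 * M - (I h1 + I h2) / 2).

Let t_itv : a <= t /\ t <= b.
Proof. by move: ht; rewrite in_itv/= => /andP. Qed.

(** At an endpoint of [[a, b]] one of the two steps is 0; [a < b] and [0 < h] keep the other
    positive. *)
Let steps : [/\ 0 <= h1, 0 <= h2, 0 < h1 + h2, a <= t - h1 & t + h2 <= b].
Proof.
have [at_ tb] := t_itv.
by move: hab hh => ab h0; split; case: (leP h (t - a)) => ?;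
  case: (leP h (b - t)) => ?; lra.
Qed.

(** [CH] asks for positive steps on both sides of a centre. Centring at the midpoint of [[u, v]]
    also covers the case where [h1] or [h2] is 0. *)
Lemma CH_hdiff_exists f u v : CH a b f -> a <= u -> u < v -> v <= b ->
  @hdiff_exists R X (f v) (f u).
Proof.
move=> [_ fH] au uv vb; have := fH ((u + v) / 2) ((v - u) / 2) ((v - u) / 2).
have -> : (u + v) / 2 + (v - u) / 2 = v by field.
have -> : (u + v) / 2 - (v - u) / 2 = u by field.
apply; [lra|lra|by apply: subset_itvScc; rewrite bnd_simp].
Qed.

Let divdiff_exists f : CH a b f -> @hdiff_exists R X (f (t + h2)) (f (t - h1)).
Proof. by move=> fCH; have [*] := steps; apply: CH_hdiff_exists => //; lra. Qed.

Lemma divdiff_dist f g (r : R) :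
    @hdiff_exists R X (f (t + h2)) (f (t - h1)) ->
    @hdiff_exists R X (g (t + h2)) (g (t - h1)) ->
    (Cdist a b f g <= r%:E)%E ->
  (h1 + h2) * mdist (divdiff h1 h2 t f) (divdiff h1 h2 t g) <= r *+ 2.
Proof.
have [h10 h20 h120 ah1 h2b] := steps => fH gH fg.
have fgr s : a <= s -> s <= b -> mdist (f s) (g s) <= r.
  move=> as_ sb; rewrite -lee_fin; apply: le_trans fg; apply: ereal_sup_ubound.
  by exists s => //; rewrite /= in_itv/= as_ sb.
rewrite mdist_lscale ger0_norm ?invr_ge0 ?(ltW h120)//.
rewrite mulVKf ?gt_eqF// (le_trans (mdist_hdiff hiso fH gH))// mulr2n.
by rewrite lerD// fgr//; lra.
Qed.

Lemma divdiff_bounded_poshom : @bounded_poshom R X a b (divdiff h1 h2 t).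
Proof.
have [h10 h20 h120 ah1 h2b] := steps; split.
- move=> f g _ _ fg; rewrite /divdiff !fg// in_itv/=; apply/andP; split; lra.
- move=> c f c0 fCH; rewrite /divdiff.
  rewrite (hdiffE hiso (z := c *s hdiff (f (t + h2)) (f (t - h1)))).
    by rewrite !lscaleA mulrC.
  by rewrite -lscaleDr -(hdiff_exists_add hiso (divdiff_exists fCH)).
(* The bound comes from [divdiff_dist] against the zero function with [r = 1]. *)
apply: (@le_lt_trans _ _ ((h1 + h2)^-1 * 2)%:E); last by rewrite ltry.
apply: ub_ereal_sup => _ [f [fCH f1] <-]; rewrite lee_fin.
have theta_hdiff : @hdiff_exists R X ltheta ltheta.
  by exists ltheta; rewrite laddr0.
have := @divdiff_dist f (fun=> ltheta) 1 (divdiff_exists fCH) theta_hdiff f1.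
rewrite {2}/divdiff (hdiffE hiso (z := ltheta)) ?laddr0// lscaler0.
by move=> le2; rewrite -(ler_pM2l h120) mulVKf ?gt_eqF.
Qed.

Lemma Udelta_divdiff_le :
  (Udelta P omega a b delta (hderiv a b t) (divdiff h1 h2 t) <= M%:E)%E.
Proof.
have [h10 h20 h120 ah1 h2b] := steps; have [at_ tb] := t_itv.
apply: ub_ereal_sup => _ [[f g] /= [[x [phi [cx phiom fE]] gCH fg]] <-].
rewrite lee_fin (hderiv_lintegral hP hom hiso phiom fE)//.
(* The integral is split at [t] so that each half can be compared with its own multiple of
   [P (phi t)]. *)
pose z := lintegral P `[t - h1, t] phi +s lintegral P `[t, t + h2] phi.
have fz : f (t + h2) = f (t - h1) +s z.
  rewrite (lintegral_increment hP hom phiom fE (c := t - h1)); [|lra..].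
  by congr (_ +s _); apply: (lintegral_itvD hP hom phiom); lra.
have fH : hdiff_exists (f (t + h2)) (f (t - h1)) by exists z.
rewrite -(ler_pM2l h120).
rewrite (le_trans (ler_wpM2l (ltW h120) (metric_triangle _ (divdiff h1 h2 t f) _)))//.
rewrite mulrDr; have := divdiff_dist fH (divdiff_exists gCH) fg.
suff : (h1 + h2) * mdist (P (phi t)) (divdiff h1 h2 t f) <= I h1 + I h2.
  move: (mdist _ _) (mdist _ _) M (I h1) (I h2) (h1 + h2) => *; lra.
(* Moving the factor inside the distance cancels the division in [divdiff]; convexity of [P (phi t)]
   then splits it into its [h1] and [h2] multiples. *)
rewrite -[h1 + h2 in X in X <= _]gtr0_norm// -mdist_lscale /divdiff lscaleA.
rewrite divff ?gt_eqF// lscale1 (hdiffE hiso fz) (convexifying_convex _ hP)//.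
rewrite metric_sym (le_trans (mdist_ladd _ _ _ _))// lerD//.
  exact: (lintegral_left_dist hP hom phiom).
exact: (lintegral_right_dist hP hom phiom).
Qed.

Let M_ge : omega h1 <= M /\ omega h2 <= M.
Proof. by rewrite !le_max !lexx orbT. Qed.

Let M0 : 0 <= M.
Proof.
have [h10 _ _ _ _] := steps; case: hom => om0 _ _ _ _.
by rewrite le_max om0.
Qed.

Local Notation J s := (\int[@lebesgue_measure R]_(r in `[a, s]) bump omega t M r).

(** The bounds [h1 * M - I h1] and [h2 * M - I h2] on the two sides of [t] add up to [2 delta]; the
    bump contributes nothing outside [[t - h1, t + h2]]. *)
Let bump_integral_le : J b <= delta *+ 2.
Proof.
have [h10 h20 h120 ah1 h2b] := steps; have [at_ tb] := t_itv.
have [Mh1 Mh2] := M_ge; case: (hom) => om0 omle _ _ _.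
have J0 : J a = 0 by rewrite set_itv1 Rintegral_set1.
have R2 := bump_integral_right hom at_ h20 Mh2.
have R1 := bump_integral_left hom ah1 h10 Mh1.
(* Both [h1] and [h2] are at most [h], so [M <= omega |s - t|] there. *)
have out s : h <= `|s - t| -> bump omega t M s = 0.
  move=> hs; apply/max_idPl; rewrite subr_le0 ge_max.
  by rewrite !omle// (le_trans _ hs)// ge_min lexx.
have Rr : J b - J (t + h2) <= 0.
  (* Either the step was cut at [b] and nothing lies beyond it, or it is the full [h] and the bump
     vanishes beyond it. *)
  have [->|hh2] : t + h2 = b \/ h <= h2.
  - by case: (leP h (b - t)) => _; [right|left; ring].
  - by rewrite subrr.
  rewrite -[leRHS](mulr0 (b - (t + h2))).
  suff /andP[] : (b - (t + h2)) * 0 <= J b - J (t + h2) <= (b - (t + h2)) * 0 by [].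
  apply: (bump_integral_increment hom); [lra|lra|] => s hs sb.
  by rewrite out ?lexx// ger0_norm; lra.
have Rl : J (t - h1) - J a <= 0.
  have [->|hh1] : t - h1 = a \/ h <= h1.
  - by case: (leP h (t - a)) => _; [right|left; ring].
  - by rewrite subrr.
  rewrite -[leRHS](mulr0 (t - h1 - a)).
  suff /andP[] : (t - h1 - a) * 0 <= J (t - h1) - J a <= (t - h1 - a) * 0 by [].
  apply: (bump_integral_increment hom); [lra|lra|] => s hs sb.
  by rewrite out ?lexx// distrC ger0_norm; lra.
move: Rr Rl R1 R2; rewrite J0; move: (J b) (J t) (J _) (J _) => *; lra.
Qed.

Lemma max_le_Udelta T : @invertible_elements R X `&` @convex_elements R X <> [set ltheta] ->
  bounded_poshom a b T ->
  (M%:E <= Udelta P omega a b delta (hderiv a b t) T)%E.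
Proof.
move=> hinv [_ Thom _]; have [at_ tb] := t_itv.
have [e [ecvx eD eM edist]] := isometric_line hiso hinv.
have bdist := bump_dist hom t M.
pose phi := e \o bump omega t M.
have phiom : Homega omega a b phi by move=> s u _ _; rewrite edist bdist.
pose f s := e (- (J b / 2)) +s lintegral P `[a, s] phi.
have fE s : s \in `[a, b] -> f s = e (- (J b / 2)) +s lintegral P `[a, s] phi by [].
have fle s : a <= s -> s <= b -> mdist (f s) (e 0) <= delta.
  move=> as_ sb; rewrite /f (lintegral_line hP hom ecvx eD eM edist bdist as_ sb).
  rewrite -eD edist subr0.
  have bM u : 0 <= bump omega t M u <= M.
    rewrite bump_ge0/= /bump ge_max M0 gerBl.
    by case: hom => om0 _ _ _ _; exact: om0.
  have J0 : J a = 0 by rewrite set_itv1 Rintegral_set1.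
  have /andP[Jsa _] : (s - a) * 0 <= J s - J a <= (s - a) * M.
    by apply: (bump_integral_increment hom).
  have /andP[Jbs _] : (b - s) * 0 <= J b - J s <= (b - s) * M.
    by apply: (bump_integral_increment hom).
  (* As the bump is nonnegative, [J] increases from 0, hence [0 <= J s <= J b]. *)
  apply: norm_center_le bump_integral_le.
    by rewrite J0 mulr0 subr0 in Jsa.
  by rewrite mulr0 subr_ge0 in Jbs.
have e0 : e 0 = ltheta by rewrite -(lscale0 (e 0)) eM// mul0r.
rewrite e0 in fle.
have theta_CH : CH a b (fun=> ltheta : X).
  split; first by move=> s; exact: cst_continuous.
  by move=> *; exists ltheta; rewrite laddr0.
have Ttheta : T (fun=> ltheta) = ltheta.
  (* The zero function is its own double, so its image equals twice itself and has norm 0. *)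
  have := Thom 2 _ (ltr0Sn R 1) theta_CH.
  under eq_fun do rewrite lscaler0.
  move=> T2; have := mdist_lscale 2 (T (fun=> ltheta)) ltheta.
  rewrite -T2 lscaler0 normr_nat mulr_natl mulr2n => /eqP.
  rewrite -subr_eq0 opprD addrA subrr sub0r oppr_eq0 => /eqP.
  exact: mdist_positivity.
apply: ereal_sup_ubound; exists (f, (fun=> ltheta)) => /=; last first.
  rewrite Ttheta (hderiv_lintegral hP hom hiso phiom fE ht hab).
  rewrite (convexifying_id hP (ecvx _)) -e0 edist bump_center// subr0.
  by rewrite ger0_norm.
split => //; first by exists (e (- (J b / 2))), phi; split.
apply: ub_ereal_sup => _ [s /= + <-]; rewrite in_itv/= => /andP[as_ sb].
by rewrite lee_fin fle.
Qed.

End Recovery.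

Theorem theorem10 (R : realType) (X : lspaceType R) (P : X -> X)
    (omega : R -> R) (a b t h : R)
    (hiso : isotropic X)
    (hinv : @invertible_elements R X `&` @convex_elements R X <> [set ltheta])
    (hP : convexifying P)
    (homega : modulus_of_continuity omega)
    (hab : a < b) (ht : t \in `[a, b]) (hh : 0 < h) :
  let h1 := Num.min h (t - a) in
  let h2 := Num.min h (b - t) in
  let I := fun x : R => \int[@lebesgue_measure R]_(s in `[0, x]) omega s in
  let delta := (h1 + h2) / 2 * Num.max (omega h1) (omega h2)
               - (I h1 + I h2) / 2 in
  [/\ @bounded_poshom R X a b (divdiff h1 h2 t),
      Edelta P omega a b delta (hderiv a b t)
        = Udelta P omega a b delta (hderiv a b t) (divdiff h1 h2 t) &
      Udelta P omega a b delta (hderiv a b t) (divdiff h1 h2 t)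
        = (Num.max (omega h1) (omega h2))%:E].
Proof.
move=> h1 h2 I delta.
have Tb : @bounded_poshom R X a b (divdiff h1 h2 t).
  exact: divdiff_bounded_poshom.
have UM : Udelta P omega a b delta (hderiv a b t) (divdiff h1 h2 t)
    = (Num.max (omega h1) (omega h2))%:E.
  apply/eqP; rewrite eq_le; apply/andP; split.
    exact: Udelta_divdiff_le.
  exact: max_le_Udelta.
(* The infimum is at most its value at the admissible operator [divdiff], and every competitor has
   error at least the maximum. *)
split => //; apply/eqP; rewrite eq_le; apply/andP; split.
  by apply: ereal_inf_lbound; exists (divdiff h1 h2 t).
rewrite UM; apply: le_ereal_inf_tmp => _ [T Tbd <-].
exact: max_le_Udelta.
Qed.
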